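(* Let $n\ge 3$ and let $n$ concentric circles with radii $d_1,d_2,\dots,d_n$ be given in the Euclidean plane. Regular $n$-gons whose vertices lie one on each of the $n$ circles exist if and only if the radii satisfy the following two conditions: (I) $$\frac{2}{3}\leq\frac{(d_1^2+d_2^2+\cdots+d_n^2)^2}{n(d_1^4+d_2^4+\cdots+d_n^4)}\leq 1;$$ (II) for every $m=3,\dots,n-1$, $$\frac{d_1^{2m}+\cdots+d_n^{2m}}{n}-\Big(\frac{d_1^2+\cdots+d_n^2}{n}\Big)^m=\sum_{k=1}^{\lfloor m/2\rfloor}\frac{1}{2^k}\binom{m}{2k}\binom{2k}{k}\Big(\frac{n(d_1^4+\cdots+d_n^4)-(d_1^2+\cdots+d_n^2)^2}{n^2}\Big)^k\Big(\frac{d_1^2+\cdots+d_n^2}{n}\Big)^{m-2k}.$$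
   Context: Circles are counted with multiplicity (the radii $d_i$ need not be distinct). ''The vertices of a regular $n$-gon lie one on each of the $n$ circles'' means that, with $M$ the common center of the circles, the multiset of distances from $M$ to the vertices of the $n$-gon is $\{d_1,\dots,d_n\}$. For $n=3$ condition (II) is vacuous. *)

(* Defs.v *)
From mathcomp Require Import all_boot all_order all_algebra.
From mathcomp Require Import reals trigo.

Set Implicit Arguments.
Unset Strict Implicit.
Unset Printing Implicit Defensive.

Import Order.TTheory GRing.Theory Num.Theory.
Local Open Scope ring_scope.

(* The Euclidean plane is ['rV[R]_2]; the norm [`|p - q|] that
   MathComp-Analysis puts on it is the sup norm, hence this definition. *)
Definition edist (R : realType) (p q : 'rV[R]_2) : R :=
  Num.sqrt (\sum_(j < 2) (p 0 j - q 0 j) ^+ 2).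

(* Vertices are listed counterclockwise; [c] is the centre, [r > 0] the
   circumradius and [t] the polar angle of vertex 0 as seen from [c]. *)
Definition regular_ngon (R : realType) (n : nat) (P : 'I_n -> 'rV[R]_2) : Prop :=
  exists (c : 'rV[R]_2) (r t : R), 0 < r /\
    forall k : 'I_n,
      P k 0 0 = c 0 0 + r * cos (t + 2 * pi * k%:R / n%:R) /\
      P k 0 1 = c 0 1 + r * sin (t + 2 * pi * k%:R / n%:R).

(* Equality of the multisets of distances and of radii, so that circles with
   equal radii are counted with multiplicity. *)
Definition vertices_one_on_each_circle (R : realType) (n : nat)
    (M : 'rV[R]_2) (d : 'I_n -> R) (P : 'I_n -> 'rV[R]_2) : Prop :=
  perm_eq [seq edist M (P k) | k : 'I_n] [seq d i | i : 'I_n].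

Definition power_sum (R : realType) (n : nat) (d : 'I_n -> R) (p : nat) : R :=
  \sum_(i < n) d i ^+ p.

(* Main.v *)
(* The squared distances from M to the vertices of a regular n-gon with
   circumradius r and centre at distance L from M are A + B cos(t + 2 pi k / n)
   with A = L^2 + r^2 and B = 2 L r.  For m < n their m-th moments do not depend
   on t and are the right-hand sides of (II); condition (I) says 0 <= B <= A.
   Conversely (I) and (II) determine A and B, and by Newton's identities the
   monic polynomials with roots d_i^2 and A + B cos(t + 2 pi k / n) differ only
   in their constant term, for every t.  The variance of the d_i^2 is B^2 / 2, so
   some d_i^2 lies in [A - B, A + B]; choosing t with A + B cos t = d_i^2 gives
   the two polynomials a common root, hence makes them equal. *)
Require Import Defs.
From mathcomp Require Import all_boot all_order all_algebra.
From mathcomp Require Import reals trigo.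
From mathcomp Require Import ring lra zify.

Set Implicit Arguments.
Unset Strict Implicit.
Unset Printing Implicit Defensive.

Import Order.TTheory GRing.Theory Num.Theory.
Local Open Scope ring_scope.

(** * Newton's identities and recovery of roots from power sums *)

Lemma deriv_prod_ord (R : comNzRingType) (n : nat) (F : 'I_n -> {poly R}) :
  (\prod_i F i)^`() = \sum_i (F i)^`() * \prod_(j | j != i) F j.
Proof.
elim: n F => [|n IHn] F; first by rewrite !big_ord0 derivC.
rewrite !big_ord_recl derivM IHn; congr (_ + _).
  congr (_ * _).
  by rewrite [RHS]big_mkcond big_ord_recl /= mul1r.
rewrite mulr_sumr; apply: eq_bigr => i _; rewrite mulrCA; congr (_ * _).
rewrite [RHS]big_mkcond big_ord_recl /=; congr (_ * _).
by rewrite big_mkcond.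
Qed.

Section Newton.
Variables (R : comNzRingType) (n : nat).
Implicit Types x y : 'I_n -> R.

Definition root_poly x : {poly R} := \prod_i ('X - (x i)%:P).
Definition deleted_poly x i : {poly R} := \prod_(j | j != i) ('X - (x j)%:P).
(** For [k < n] this is, up to sign, the sum over [i] of [x i ^+ m] times the elementary symmetric
    polynomial of degree [n - 1 - k] in the other variables. *)
Definition deleted_coef_sum x k m : R := \sum_i x i ^+ m * (deleted_poly x i)`_k.

Lemma root_poly_coefS x i k :
  (root_poly x)`_k.+1 = (deleted_poly x i)`_k - x i * (deleted_poly x i)`_k.+1.
Proof.
by rewrite /root_poly (bigD1 i) //= mulrBl coefB coefXM /= coefCM.
Qed.

(** Weighting [root_poly_coefS] by [x i ^+ m] and summing raises both indices by one; iteration ends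
    once [k] reaches [n]. *)
Lemma deleted_coef_sumE x k m :
  deleted_coef_sum x k m =
    (\sum_i x i ^+ m) * (root_poly x)`_k.+1 + deleted_coef_sum x k.+1 m.+1.
Proof.
rewrite /deleted_coef_sum mulr_suml -big_split; apply: eq_bigr => i _ /=.
by rewrite (root_poly_coefS x i k) exprSr; ring.
Qed.

(** The deleted polynomials add up to the derivative of [root_poly x]. *)
Lemma deleted_coef_sum0 x k :
  deleted_coef_sum x k 0 = (root_poly x)`_k.+1 *+ k.+1.
Proof.
rewrite -coef_deriv deriv_prod_ord coef_sum; apply: eq_bigr => i _.
by rewrite derivXsubC !mul1r.
Qed.

Lemma deleted_coef_sum_ge x k m : (n <= k)%N -> deleted_coef_sum x k m = 0.
Proof.
move=> lenk; rewrite /deleted_coef_sum big1 // => i _.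
rewrite nth_default ?mulr0 // (leq_trans _ lenk) // -ltnS.
have dmonic : deleted_poly x i \is monic by apply: monic_prod_XsubC.
have := size_prod_XsubC (index_enum 'I_n) x.
rewrite (bigD1 i) //= size_monicM ?monicXsubC ?monic_neq0 //.
rewrite size_XsubC /= -/(deleted_poly x i) [index_enum _]unlock -enumT.
by rewrite size_enum_ord add1n => -[->].
Qed.

End Newton.

(* Newton's identities: for [0 < k < n] the [k]-th coefficient is a combination,
   with coefficients power sums of exponent less than [n], of higher ones. *)
Lemma root_poly_coef_eq (R : numDomainType) (n : nat) (x y : 'I_n -> R) :
  (forall m, (0 < m < n)%N -> \sum_i x i ^+ m = \sum_i y i ^+ m) ->
  forall k, (0 < k)%N -> (root_poly x)`_k = (root_poly y)`_k.
Proof.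
move=> eq_sums.
(* Induction from the leading coefficient down; [t = n] covers every positive index. *)
suff H t : forall k, (n - t < k)%N -> (0 < k)%N -> (root_poly x)`_k = (root_poly y)`_k.
  by move=> k k_gt0; apply: (H n) => //; rewrite subnn.
have size_rp (z : 'I_n -> R) : size (root_poly z) = n.+1.
  by rewrite size_prod_XsubC [index_enum _]unlock -enumT size_enum_ord.
elim: t => [|t IHt] k.
  by rewrite subn0 => ltnk _; rewrite !nth_default ?size_rp.
move=> ltk k_gt0; have [/IHt->//|lekt] := ltnP (n - t) k.
case: k k_gt0 ltk lekt => // k _ ltk lekt.
have [eqn|neqn] := eqVneq k.+1 n.
  have lead (z : 'I_n -> R) : (root_poly z)`_k.+1 = 1.
    have /monicP := monic_prod_XsubC (index_enum 'I_n) predT z.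
    by rewrite /lead_coef size_rp /= eqn.
  by rewrite !lead.
have {}neqn : (k.+1 < n)%N by rewrite ltn_neqAle neqn; lia.
(* Downward induction on [j]: [m <= j < n] keeps the power sums within the hypothesis, and [k < j]
   makes the coefficient of index [j.+1] one already compared. *)
have eqS s : forall j m, (n - s <= j)%N -> (k < j)%N -> (0 < m <= j)%N ->
    deleted_coef_sum x j m = deleted_coef_sum y j m.
  elim: s => [|s IHs] j m lej ltj mj.
    by rewrite !deleted_coef_sum_ge //; lia.
  have [lenj|ltjn] := leqP n j; first by rewrite !deleted_coef_sum_ge.
  rewrite (deleted_coef_sumE x) (deleted_coef_sumE y) IHs; try lia.
  by rewrite IHt ?eq_sums //; lia.
(* The two evaluations of [deleted_coef_sum] at [k] and 0 leave the coefficient with the factor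
   [n - k.+1], which is positive and cancels. *)
have /eqP : (root_poly x)`_k.+1 *+ (n - k.+1) = (root_poly y)`_k.+1 *+ (n - k.+1).
  have rec (z : 'I_n -> R) :
      (root_poly z)`_k.+1 *+ (n - k.+1) = - deleted_coef_sum z k.+1 1.
    rewrite mulrnBr 1?ltnW // -deleted_coef_sum0 deleted_coef_sumE.
    rewrite (eq_bigr (fun=> 1)) // sumr_const card_ord -mulr_natl; ring.
  by rewrite !rec (eqS n) //; lia.
by rewrite eqr_pMn2r ?subn_gt0 // => /eqP.
Qed.

(** Power sums of exponent below [n] leave only the constant coefficient free; evaluation at the
    common root shows that it agrees too. *)
Lemma perm_eq_power_sums (R : numFieldType) (n : nat) (x y : 'I_n -> R) (i k : 'I_n) :
  (forall m, (0 < m < n)%N -> \sum_i x i ^+ m = \sum_i y i ^+ m) ->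
  x i = y k -> perm_eq [seq x i | i : 'I_n] [seq y i | i : 'I_n].
Proof.
move=> eq_sums eqxy; apply: prod_XsubC_eq; rewrite !big_image /=.
rewrite -/(root_poly x) -/(root_poly y).
have diff_const : root_poly x - root_poly y = ((root_poly x)`_0 - (root_poly y)`_0)%:P.
  apply/polyP => -[|j]; rewrite coefB coefC //=.
  by rewrite (root_poly_coef_eq eq_sums) // subrr.
have root0 (z : 'I_n -> R) j : (root_poly z).[z j] = 0.
  by rewrite /root_poly (bigD1 j) //= hornerM hornerXsubC subrr mul0r.
have := congr1 (horner^~ (y k)) diff_const.
rewrite /= hornerD hornerN hornerC root0 -{1}eqxy root0 subr0 => const0.
by apply/eqP; rewrite -subr_eq0 diff_const -const0.
Qed.

(** * Moments of the cosine at equally spaced angles *)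

Lemma sum_binS (V : nmodType) (F : nat -> V) m :
  \sum_(j < m.+2) F j *+ 'C(m.+1, j) = \sum_(j < m.+1) (F j + F j.+1) *+ 'C(m, j).
Proof.
rewrite big_ord_recl bin0 /=.
under eq_bigr => j _ do rewrite /bump /= add1n binS mulrnDr.
rewrite big_split /= addrA; under [RHS]eq_bigr => j _ do rewrite mulrnDl.
rewrite [RHS]big_split /=; congr (_ + _).
by rewrite [in RHS]big_ord_recl bin0 big_ord_recr /= bin_small // mulr0n addr0.
Qed.

Lemma sum_even (V : nmodType) (F : nat -> V) m :
  (forall j, odd j -> F j = 0) ->
  \sum_(0 <= j < m.+1) F j = \sum_(0 <= k < (m %/ 2).+1) F (2 * k)%N.
Proof.
move=> Fodd; rewrite divn2; elim: m => [|m IHm]; first by rewrite !big_nat1.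
rewrite big_nat_recr //= IHm uphalf_half.
have := odd_double_half m; case: (boolP (odd m)) => oddm /= mE.
  rewrite [RHS]big_nat_recr //=; congr (_ + F _).
  by rewrite mul2n doubleS -[in LHS]mE.
by rewrite add0n Fodd ?addr0.
Qed.

Section CosineMoments.
Variable R : realType.
Implicit Types (A B t : R) (n m : nat).

(** The real form of the binomial expansion of (e^(it) + e^(-it))^m; the induction combines Pascal's
    rule with the product-to-sum formula. *)
Lemma exp_2cos t m :
  (2 * cos t) ^+ m = \sum_(j < m.+1) cos ((m%:R - 2 * j%:R) * t) *+ 'C(m, j).
Proof.
elim: m => [|m IHm].
  by rewrite big_ord1 /= mulr0 subrr mul0r cos0.
rewrite exprS IHm (sum_binS (fun j => cos ((m.+1%:R - 2 * j%:R) * t))) mulr_sumr.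
apply: eq_bigr => j _; rewrite (mulrnAr (2 * cos t)); congr (_ *+ _).
have -> : (m.+1%:R - 2 * j%:R) * t = (m%:R - 2 * j%:R) * t + t.
  by rewrite -natr1; ring.
have -> : (m.+1%:R - 2 * j.+1%:R) * t = (m%:R - 2 * j%:R) * t - t.
  by rewrite -!natr1; ring.
by rewrite cosD cosB; ring.
Qed.

Lemma sum_cos_multiple t n a : (0 < a < n)%N ->
  \sum_(k < n) cos (a%:R * (t + 2 * pi * k%:R / n%:R)) = 0.
Proof.
move=> /andP[a_gt0 ltan]; have n_gt0 : 0 < n%:R :> R by rewrite ltr0n; lia.
(* Half the increment of the angles: the factor 2 sin h makes the sum telescope, and 0 < h < pi
   makes it nonzero. *)
pose h : R := a%:R * pi / n%:R.
have sin_h_n0 : 2 * sin h != 0.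
  rewrite mulf_neq0 ?pnatr_eq0 //; apply/lt0r_neq0/sin_gt0_pi.
  rewrite divr_gt0 ?mulr_gt0 ?(ltr0n _ a) ?pi_gt0 //=.
  by rewrite ltr_pdivrMr // mulrC ltr_pM2l ?pi_gt0 // ltr_nat.
apply: (mulfI sin_h_n0); rewrite mulr0 mulr_sumr.
rewrite -(big_mkord predT (fun k : nat => 2 * sin h *
  cos (a%:R * (t + 2 * pi * k%:R / n%:R)))).
rewrite (telescope_sumr_eq (fun k => sin (a%:R * t - h + 2 * h * k%:R))) //.
  (* The two ends of the telescope differ by [a] full turns. *)
  have -> : a%:R * t - h + 2 * h * n%:R = a%:R * t - h + 2 * h * 0%:R + pi *+ 2 *+ a.
    by rewrite -(mulr_natr (pi *+ 2)) -(mulr_natr pi) /h; field; rewrite gt_eqF.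
  by rewrite (periodicn (@sinD2pi R)) subrr.
move=> k _; set u := a%:R * _.
have -> : a%:R * t - h + 2 * h * k.+1%:R = u + h.
  by rewrite /u /h -natr1; field; rewrite gt_eqF.
have -> : a%:R * t - h + 2 * h * k%:R = u - h.
  by rewrite /u /h; field; rewrite gt_eqF.
by rewrite sinD sinB; ring.
Qed.

(** The frequencies m - 2j in [exp_2cos] are at most m < n in absolute value, so only frequency zero
    survives, and it occurs for even m only. *)
Lemma sum_cos_exp t n m : (m < n)%N ->
  \sum_(k < n) cos (t + 2 * pi * k%:R / n%:R) ^+ m =
    if odd m then 0 else n%:R * 'C(m, m./2)%:R / 2 ^+ m.
Proof.
move=> ltmn; have two_n0 : 2 ^+ m != 0 :> R by rewrite expf_neq0 // pnatr_eq0.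
apply: (mulfI two_n0); rewrite mulr_sumr.
under eq_bigr => k _ do rewrite -exprMn exp_2cos.
rewrite exchange_big /=.
have inner (j : 'I_m.+1) :
    \sum_(k < n) cos ((m%:R - 2 * j%:R) * (t + 2 * pi * k%:R / n%:R)) *+ 'C(m, j)
      = if m == j.*2 then n%:R *+ 'C(m, j) else 0.
  rewrite sumrMnl; have [mE|mj|jm] := ltngtP m j.*2.
  - under eq_bigr => k _ do rewrite -cosN -mulNr opprB -natrM mul2n -natrB ?(ltnW mE) //.
    by rewrite sum_cos_multiple ?mul0rn //; have := ltn_ord j; lia.
  - under eq_bigr => k _ do rewrite -natrM mul2n -natrB ?(ltnW mj) //.
    by rewrite sum_cos_multiple ?mul0rn //; lia.
  - rewrite (eq_bigr (fun=> 1)) ?sumr_const ?card_ord // => k _.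
    by rewrite -natrM mul2n -jm subrr mul0r cos0.
under eq_bigr => j _ do rewrite inner.
case: ifP => oddm.
  rewrite mulr0 big1 // => j _; case: eqP => // mE.
  by rewrite mE odd_double in oddm.
have mE : m = (m./2).*2 by have := odd_double_half m; rewrite oddm.
have ltm2 : (m./2 < m.+1)%N by lia.
rewrite (bigD1 (Ordinal ltm2)) //= -mE eqxx big1 ?addr0.
  by rewrite -mulr_natr; field.
move=> j; rewrite -val_eqE /= => /eqP nej; case: eqP => // mE'; exfalso; apply: nej; lia.
Qed.

(** The mean of (A + B cos)^m over a full period, with [S] = B^2 / 2 the variance. The term k = 0 is
    A^m, which (II) carries on its left-hand side. *)
Definition cos_moment A S m : R :=
  \sum_(0 <= k < (m %/ 2).+1)
    1 / 2 ^+ k * 'C(m, 2 * k)%:R * 'C(2 * k, k)%:R * S ^+ k * A ^+ (m - 2 * k).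

Lemma sum_affine_cos_exp A B t n m : (m < n)%N ->
  \sum_(k < n) (A + B * cos (t + 2 * pi * k%:R / n%:R)) ^+ m =
    n%:R * cos_moment A (B ^+ 2 / 2) m.
Proof.
move=> ltmn; under eq_bigr => k _ do rewrite exprDn.
rewrite exchange_big /=.
pose F j := A ^+ (m - j) * B ^+ j *+ 'C(m, j) *
  (if odd j then 0 else n%:R * 'C(j, j./2)%:R / 2 ^+ j).
rewrite (eq_bigr (fun j : 'I_m.+1 => F j)); last first.
  move=> j _; rewrite /F -(sum_cos_exp t); last by have := ltn_ord j; lia.
  by rewrite mulr_sumr; apply: eq_bigr => k _; rewrite exprMn [RHS]mulrnAl mulrA.
rewrite -(big_mkord predT F) sum_even; last by move=> j oddj; rewrite /F oddj mulr0.
rewrite /cos_moment mulr_sumr; apply: eq_bigr => k _.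
rewrite /F mul2n odd_double doubleK -mul2n !exprM expr_div_n -mulr_natr.
have -> : 2 ^+ 2 = 2 * 2 :> R by rewrite expr2.
have c_neq0 : 2 ^+ k != 0 :> R by rewrite expf_neq0 // pnatr_eq0.
rewrite [(2 * 2) ^+ k]exprMn; move: (2 ^+ k) c_neq0 => c c_neq0.
by move: ('C(m, _)) ('C(_, k)) (m - _)%N => a b e; field.
Qed.

Lemma cos_moment1 A S : cos_moment A S 1 = A.
Proof. by rewrite /cos_moment big_nat1 /= muln0 !bin0 !expr0 subn0; field. Qed.

Lemma cos_moment2 A S : cos_moment A S 2 = A ^+ 2 + S.
Proof.
rewrite /cos_moment big_nat_recr //= big_nat1 muln0 subn0 muln1 subnn.
by rewrite !bin0 binn bin1 !expr0 !expr1; field.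
Qed.

Lemma cos_momentE A S m : cos_moment A S m - A ^+ m =
  \sum_(1 <= k < (m %/ 2).+1)
    1 / 2 ^+ k * 'C(m, 2 * k)%:R * 'C(2 * k, k)%:R * S ^+ k * A ^+ (m - 2 * k).
Proof.
rewrite /cos_moment big_ltn // muln0 subn0 !bin0 !expr0.
by rewrite invr1 !mul1r addrAC subrr add0r.
Qed.

End CosineMoments.

(** * Distances from a point to the vertices of a regular polygon *)

Section Geometry.
Variable R : realType.

Lemma edist_sqr (p q : 'rV[R]_2) :
  edist p q ^+ 2 = (p 0 0 - q 0 0) ^+ 2 + (p 0 1 - q 0 1) ^+ 2.
Proof.
rewrite /edist sqr_sqrtr; last by apply: sumr_ge0 => j _; exact: sqr_ge0.
rewrite big_ord_recl big_ord1; congr ((p 0 _ - q 0 _) ^+ 2 + (p 0 _ - q 0 _) ^+ 2).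
all: exact/val_inj.
Qed.

Lemma edist_ge0 (p q : 'rV[R]_2) : 0 <= edist p q.
Proof. exact: sqrtr_ge0. Qed.

Lemma polar_coordinates (u v : R) :
  exists L s, 0 <= L /\ u = L * cos s /\ v = L * sin s.
Proof.
pose L := Num.sqrt (u ^+ 2 + v ^+ 2).
have L2 : L ^+ 2 = u ^+ 2 + v ^+ 2 by rewrite sqr_sqrtr // addr_ge0 ?sqr_ge0.
have [L0|L_neq0] := eqVneq L 0.
  exists 0, 0; split=> //; rewrite !mul0r; move: L2; rewrite L0 expr0n /=.
  by move/esym/eqP; rewrite paddr_eq0 ?sqr_ge0 // !sqrf_eq0 => /andP[/eqP-> /eqP->].
have L_gt0 : 0 < L by rewrite lt_def L_neq0 sqrtr_ge0.
have uL : -1 <= u / L <= 1.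
  rewrite -ler_norml -(@ler_pXn2r _ 2) ?nnegrE // expr1n.
  rewrite real_normK ?num_real // expr_div_n L2 ler_pdivrMr ?mul1r.
    by rewrite lerDl sqr_ge0.
  by rewrite -L2 exprn_gt0.
have uE : u = L * cos (acos (u / L)).
  by rewrite acosK ?in_itv //= mulrCA divff ?mulr1.
have vE : `|v| = L * sin (acos (u / L)).
  rewrite sin_acos //.
  have -> : 1 - (u / L) ^+ 2 = (v / L) ^+ 2.
    by rewrite !expr_div_n L2; field; rewrite -L2 expf_neq0.
  by rewrite sqrtr_sqr normrM normfV (gtr0_norm L_gt0) mulrCA divff ?mulr1.
(* [acos] has values in [0, pi], where the sine is nonnegative, so a negative [v] takes the opposite
   angle. *)
have [v_ge0|v_lt0] := leP 0 v.
  by exists L, (acos (u / L)); rewrite -vE ger0_norm // ltW.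
exists L, (- acos (u / L)).
by rewrite cosN sinN mulrN -vE ltr0_norm // opprK ltW.
Qed.

Lemma regular_ngon_edist (n : nat) (M : 'rV[R]_2) (P : 'I_n -> 'rV[R]_2) :
  regular_ngon P ->
  exists A B t, 0 < A /\ 0 <= B <= A /\
    forall k : 'I_n, edist M (P k) ^+ 2 = A + B * cos (t + 2 * pi * k%:R / n%:R).
Proof.
move=> [c [r [t [r_gt0 PE]]]].
have [L [s [L_ge0 [uE vE]]]] := polar_coordinates (c 0 0 - M 0 0) (c 0 1 - M 0 1).
(* Law of cosines, with [L] and [s] the polar coordinates of the centre seen from [M]. *)
exists (L ^+ 2 + r ^+ 2), (2 * r * L), (t - s).
split; first by rewrite ltr_wpDl ?sqr_ge0 ?exprn_gt0.
split.
  apply/andP; split; first by rewrite !mulr_ge0 // ltW.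
  rewrite -subr_ge0.
  by rewrite (_ : _ - _ = (L - r) ^+ 2) ?sqr_ge0 //; ring.
move=> k; have [P0 P1] := PE k; rewrite edist_sqr P0 P1.
set th := _ / _; rewrite (addrAC t) cosB.
rewrite -[M 0 0](subKr (c 0 0)) -[M 0 1](subKr (c 0 1)) uE vE.
have e1 := cos2Dsin2 s; have e2 := cos2Dsin2 (t + th).
transitivity (L ^+ 2 * (cos s ^+ 2 + sin s ^+ 2) +
    r ^+ 2 * (cos (t + th) ^+ 2 + sin (t + th) ^+ 2) +
    2 * r * L * (cos (t + th) * cos s + sin (t + th) * sin s)); first by ring.
by rewrite e1 e2 !mulr1.
Qed.

Lemma exists_regular_ngon_edist (n : nat) (M : 'rV[R]_2) (A B t : R) :
  0 < A -> 0 <= B <= A ->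
  exists P : 'I_n -> 'rV[R]_2, regular_ngon P /\
    forall k, edist M (P k) ^+ 2 = A + B * cos (t + 2 * pi * k%:R / n%:R).
Proof.
move=> A_gt0 /andP[B_ge0 leBA].
(* Since A + B = (r + L)^2 and A - B = (r - L)^2, [a] and [b] play the roles of r + L and r - L. *)
pose a := Num.sqrt (A + B); pose b := Num.sqrt (A - B).
have a2 : a ^+ 2 = A + B by rewrite sqr_sqrtr ?addr_ge0 // ltW.
have b2 : b ^+ 2 = A - B by rewrite sqr_sqrtr ?subr_ge0.
have a_gt0 : 0 < a by rewrite sqrtr_gt0 ltr_wpDr.
have b_ge0 : 0 <= b by exact: sqrtr_ge0.
pose r := (a + b) / 2; pose L := (a - b) / 2.
have AE : A = L ^+ 2 + r ^+ 2.
  have -> : A = (a ^+ 2 + b ^+ 2) / 2 by rewrite a2 b2; field.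
  by rewrite /L /r; field.
have BE : B = 2 * r * L.
  have -> : B = (a ^+ 2 - b ^+ 2) / 2 by rewrite a2 b2; field.
  by rewrite /L /r; field.
(* The centre is seen from [M] at polar angle 0, so [t] is not shifted. *)
pose c : 'rV[R]_2 := \row_j (M 0 j + if j == 0 then L else 0).
pose th (k : 'I_n) := t + 2 * pi * k%:R / n%:R.
exists (fun k => \row_j (c 0 j + r * if j == 0 then cos (th k) else sin (th k))).
split.
  exists c, r, t; split; first by rewrite /r; lra.
  by move=> k; split; rewrite !mxE.
move=> k; rewrite edist_sqr !mxE /= -/(th k).
transitivity (L ^+ 2 + 2 * r * L * cos (th k) +
  r ^+ 2 * (cos (th k) ^+ 2 + sin (th k) ^+ 2)); first by ring.
by rewrite cos2Dsin2 AE BE; ring.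
Qed.

End Geometry.

(** * From distances to conditions (I) and (II), and back *)

Lemma power_sum_perm (R : realType) (n : nat) (x y : 'I_n -> R) p :
  perm_eq [seq x k | k : 'I_n] [seq y i | i : 'I_n] -> power_sum y p = power_sum x p.
Proof.
move=> xy; transitivity (\sum_(z <- [seq y i | i : 'I_n]) z ^+ p).
  by rewrite big_image.
by rewrite -(perm_big _ xy) big_image.
Qed.

Lemma exists_sqr_dev_le (R : realFieldType) (n : nat) (x : 'I_n -> R) (A C : R) :
  (0 < n)%N -> \sum_i (x i - A) ^+ 2 <= n%:R * C -> exists i, (x i - A) ^+ 2 <= C.
Proof.
move=> n_gt0 le_sum; apply/existsP; apply: contraLR le_sum => /existsPn gtC.
rewrite -ltNge mulr_natl -[n in C *+ n]card_ord -sumr_const.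
by apply: ltr_sum => [|i _]; [apply/hasP; exists (Ordinal n_gt0) | rewrite ltNge gtC].
Qed.

Theorem theorem2p3 (R : realType) (n : nat) (hn : (3 <= n)%N)
    (M : 'rV[R]_2) (d : 'I_n -> R) (hd : forall i, 0 < d i) :
  (exists P : 'I_n -> 'rV[R]_2,
      regular_ngon P /\ vertices_one_on_each_circle M d P)
  <->
  (2 / 3 <= power_sum d 2 ^+ 2 / (n%:R * power_sum d 4) <= 1 /\
   forall m : nat, (3 <= m <= n - 1)%N ->
     power_sum d (2 * m) / n%:R - (power_sum d 2 / n%:R) ^+ m
     = \sum_(1 <= k < (m %/ 2).+1)
         1 / 2 ^+ k * 'C(m, 2 * k)%:R * 'C(2 * k, k)%:R
         * ((n%:R * power_sum d 4 - power_sum d 2 ^+ 2) / n%:R ^+ 2) ^+ k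
         * (power_sum d 2 / n%:R) ^+ (m - 2 * k)).
Proof.
have n_gt0 : (0 < n)%N by lia.
have nR_gt0 : 0 < n%:R :> R by rewrite ltr0n.
have nR_neq0 := lt0r_neq0 nR_gt0.
split.
  move=> [P [/(regular_ngon_edist M)[A [B [t [A_gt0 [/andP[B_ge0 leBA] distE]]]]] perm]].
  pose S := B ^+ 2 / 2.
  have momentE m : (m < n)%N -> power_sum d (2 * m) = n%:R * cos_moment A S m.
    move=> ltmn; rewrite (power_sum_perm _ perm) -(sum_affine_cos_exp A B t ltmn).
    by apply: eq_bigr => k _; rewrite exprM distE.
  have p2E : power_sum d 2 = n%:R * A.
    by rewrite -(cos_moment1 A S) -momentE //; lia.
  have p4E : power_sum d 4 = n%:R * (A ^+ 2 + S) by rewrite -cos_moment2 -momentE.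
  have S_ge0 : 0 <= S by rewrite divr_ge0 // sqr_ge0.
  have A2_gt0 : 0 < A ^+ 2 by rewrite exprn_gt0.
  have ratioE : power_sum d 2 ^+ 2 / (n%:R * power_sum d 4) = A ^+ 2 / (A ^+ 2 + S).
    rewrite p2E p4E; field; rewrite nR_neq0 andbT lt0r_neq0 //; lra.
  have SE : (n%:R * power_sum d 4 - power_sum d 2 ^+ 2) / n%:R ^+ 2 = S.
    by rewrite p2E p4E; field.
  have AE : power_sum d 2 / n%:R = A by rewrite p2E mulrC mulKf.
  have AS_gt0 : 0 < A ^+ 2 + S by lra.
  (* By [ratioE], this form of [B <= A] is exactly the lower bound 2/3. *)
  have le2SA : 2 * S <= A ^+ 2 by rewrite mulrC divfK ?pnatr_eq0 // ler_pXn2r // nnegrE ltW.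
  split; first by rewrite ratioE ler_pdivlMr // ler_pdivrMr //; apply/andP; split; lra.
  move=> m /andP[_ lem]; rewrite SE AE -cos_momentE momentE; last by lia.
  by rewrite mulrC mulKf.
move=> [/andP[ratio_ge ratio_le] moments].
pose A := power_sum d 2 / n%:R.
pose S := (n%:R * power_sum d 4 - power_sum d 2 ^+ 2) / n%:R ^+ 2.
(* The moments 1 and 2 are right by the choice of [A] and [S]; the others are (II). *)
have momentE m : (0 < m < n)%N -> \sum_i (d i ^+ 2) ^+ m = n%:R * cos_moment A S m.
  have -> : \sum_i (d i ^+ 2) ^+ m = power_sum d (2 * m).
    by apply: eq_bigr => i _; rewrite exprM.
  move=> /andP[m_gt0 ltmn]; have [m_ge3|] := leqP 3 m.
    have := moments m; rewrite -/A -/S -cos_momentE => /(_ _)/addIr <-; last by lia.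
    by field.
  case: m m_gt0 ltmn => [|[|[|//]]] // _ _ _.
    by rewrite cos_moment1 /A; field.
  by rewrite cos_moment2 /A /S; field.
have p_gt0 p : 0 < power_sum d p.
  rewrite /power_sum (bigD1 (Ordinal n_gt0)) //= ltr_wpDr ?exprn_gt0 //.
  by apply: sumr_ge0 => i _; rewrite exprn_ge0 ?ltW.
have A_gt0 : 0 < A by rewrite divr_gt0.
have np4_gt0 : 0 < n%:R * power_sum d 4 by rewrite mulr_gt0.
have n2_gt0 : 0 < n%:R ^+ 2 :> R by rewrite exprn_gt0.
have S_ge0 : 0 <= S.
  by rewrite divr_ge0 ?sqr_ge0 // subr_ge0; move: ratio_le; rewrite ler_pdivrMr ?mul1r.
have le2SA : 2 * S <= A ^+ 2.
  rewrite /S /A expr_div_n mulrA ler_pM2r ?invr_gt0 //.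
  by move: ratio_ge; rewrite ler_pdivlMr //; lra.
pose B := Num.sqrt (2 * S).
have B2 : B ^+ 2 = 2 * S by rewrite sqr_sqrtr //; lra.
have B_ge0 : 0 <= B by exact: sqrtr_ge0.
have leBA : B <= A by rewrite -(@ler_pXn2r _ 2) ?nnegrE ?B2 // ltW.
have SE : S = B ^+ 2 / 2 by rewrite B2; field.
(* The mean of these squared deviations is [S] = B^2 / 2, which is at most B^2. *)
have [i xi] : exists i, (d i ^+ 2 - A) ^+ 2 <= B ^+ 2.
  apply: exists_sqr_dev_le => //.
  have -> : \sum_i (d i ^+ 2 - A) ^+ 2 = n%:R * S.
    transitivity (\sum_i (d i ^+ 2) ^+ 2 - 2 * A * \sum_i (d i ^+ 2) ^+ 1 + n%:R * A ^+ 2).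
      rewrite (eq_bigr (fun k => (d k ^+ 2) ^+ 2 - 2 * A * (d k ^+ 2) ^+ 1 + A ^+ 2)).
        by rewrite big_split sumrB -mulr_sumr /= sumr_const card_ord -[_ *+ n]mulr_natl.
      by move=> k _; ring.
    by rewrite !momentE ?cos_moment1 ?cos_moment2 //; [ring | lia].
  by rewrite B2 ler_pM2l //; lra.
have [t cost] : exists t, d i ^+ 2 = A + B * cos t.
  (* For [B = 0] the bound [xi] forces [d i ^+ 2 = A], and any angle serves. *)
  exists (acos ((d i ^+ 2 - A) / B)); have [B0|B_neq0] := eqVneq B 0.
    move: xi; rewrite B0 expr0n /= mul0r addr0 => xi.
    by apply/eqP; rewrite -subr_eq0 -sqrf_eq0 eq_le xi sqr_ge0.
  have B_gt0 : 0 < B by rewrite lt_def B_neq0.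
  rewrite acosK; first by rewrite mulrCA divff // mulr1 addrC subrK.
  rewrite in_itv /= -ler_norml normrM normfV (gtr0_norm B_gt0) ler_pdivrMr // mul1r.
  by rewrite -(@ler_pXn2r _ 2) ?nnegrE // real_normK ?num_real.
have [||P [regP distE]] := @exists_regular_ngon_edist R n M A B t => //.
  by rewrite B_ge0.
exists P; split=> //; rewrite /vertices_one_on_each_circle.
pose k0 := Ordinal n_gt0.
(* Vertex 0 has angle [t], so its squared distance is [d i ^+ 2], the common value needed. *)
have permsq : perm_eq [seq edist M (P k) ^+ 2 | k : 'I_n] [seq d j ^+ 2 | j : 'I_n].
  apply: (@perm_eq_power_sums _ _ _ _ k0 i).
    move=> m mn; rewrite momentE //; case/andP: mn => _ ltmn.
    rewrite SE -(sum_affine_cos_exp A B t ltmn).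
    by apply: eq_bigr => k _; rewrite distE.
  by rewrite distE cost /= mulr0 mul0r addr0.
have map_sqrt (x : 'I_n -> R) : (forall k, 0 <= x k) ->
    map Num.sqrt [seq x k ^+ 2 | k : 'I_n] = [seq x k | k : 'I_n].
  move=> x_ge0; rewrite /image_mem -map_comp; apply: eq_map => k /=.
  by rewrite sqrtr_sqr ger0_norm.
have := perm_map Num.sqrt permsq.
by rewrite !map_sqrt // => k; [exact: ltW | exact: edist_ge0].
Qed.
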